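(* Let $n\ge1$, $G=SL_{n+1}(\mathbb{C})$, and for $a=(a_{k,j})_{1\le k\le j\le n}\in(\mathbb{C}^\times)^{n(n+1)/2}$ let $$Y(a)=\big(y_n(a_{1,n})y_{n-1}(a_{1,n-1})\cdots y_1(a_{1,1})\big)\big(y_n(a_{2,n})\cdots y_2(a_{2,2})\big)\cdots\big(y_n(a_{n,n})\big)\in U^-.$$ For $i\in\{1,\dots,n\}$ and $0\le k\le i$ put $$C^{(i)}_k:=\frac{\alpha(a_{1,i}+\cdots+a_{k,i})+a_{k+1,i}+\cdots+a_{i,i}}{a_{1,i}+\cdots+a_{i,i}}$$ (so $C^{(i)}_0=1$). Then, as rational maps in $\alpha\in\mathbb{C}^\times$ and $a$, one has $e_i^\alpha\,Y\big((a_{k,j})_{1\le k\le j\le n}\big)=Y\big((a'_{k,j})_{1\le k\le j\le n}\big)$ with $$a'_{k,j}=\begin{cases}C^{(i)}_k\,a_{k,i-1}&\text{if }j=i-1,\\[2pt] \dfrac{a_{k,i}}{C^{(i)}_{k-1}C^{(i)}_k}&\text{if }j=i,\\[4pt] C^{(i)}_{k-1}\,a_{k,i+1}&\text{if }j=i+1,\\[2pt] a_{k,j}&\text{otherwise.}\end{cases}$$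
   Context: $U$ (resp. $U^-$) is the group of upper (resp. lower) unitriangular matrices in $SL_{n+1}(\mathbb{C})$, $T$ the diagonal torus; $x_i(a)=1+aE_{i,i+1}$, $y_i(a)=1+aE_{i+1,i}$. Every $g$ in the dense open subset $U^-TU$ of $SL_{n+1}(\mathbb{C})$ is uniquely $g=g^-g^0g^+$ with $g^-\in U^-,g^0\in T,g^+\in U$; put $\pi^{--}(g)=g^-$. For $u\in U^-$ let $\varphi_i(u)$ be the value at $u$ of the homomorphism $U^-\to(\mathbb{C},+)$ sending $y_j(t)$ to $\delta_{ij}t$. The rational morphism $e_i:\mathbb{C}^\times\times U^-\to U^-$ is $$e_i^\alpha(u)=\pi^{--}\Big(x_i\Big(\frac{\alpha-1}{\varphi_i(u)}\Big)u\Big).$$ *)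

(* Defs.v *)
From HB Require Import structures.
From mathcomp Require Import all_boot all_order all_algebra.
From mathcomp Require Import boolp classical_sets.
From mathcomp Require Import mpoly.

Set Implicit Arguments.
Unset Strict Implicit.
Unset Printing Implicit Defensive.

Import GRing.Theory.
Local Open Scope ring_scope.

(* All indices i, j, k are 1-based natural numbers, with 1 <= i, j, k <= n; the
   matrix entry E_{r,s} is therefore stored at row r - 1 and column s - 1. *)

Section UnitriangularGroups.
Variables (F : fieldType) (n : nat).
Implicit Types (g u v t : 'M[F]_n.+1) (i j : nat) (a : F).

Definition lower_unitri u : bool := is_trig_mx u && [forall r, u r r == 1].

Definition upper_unitri u : bool := lower_unitri u^T.

(* The diagonal torus of SL_{n+1}. *)
Definition diag_torus t : bool := is_diag_mx t && (\det t == 1).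

(* x_i(a) = 1 + a E_{i,i+1}. *)
Definition x_ i a : 'M[F]_n.+1 := 1 + a *: delta_mx (inord i.-1) (inord i).

(* y_i(a) = 1 + a E_{i+1,i}. *)
Definition y_ i a : 'M[F]_n.+1 := 1 + a *: delta_mx (inord i) (inord i.-1).

(* v is the factor g^- in a factorization g = g^- g^0 g^+ in U^- T U. *)
Definition lower_factor g v : Prop :=
  exists t w, [/\ lower_unitri v, diag_torus t, upper_unitri w & g = v * t * w].

Definition big_cell g : Prop := exists v, lower_factor g v.

(* The lower factor is unique when it exists; the value off the big cell is
   irrelevant. *)
Definition pi_mm g : 'M[F]_n.+1 := xget 1 [set v | lower_factor g v].

(* A homomorphism U^- -> (F, +), as a function on matrices whose values off U^-
   are irrelevant. *)
Definition is_phi i (f : 'M[F]_n.+1 -> F) : Prop :=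
  (forall u v, lower_unitri u -> lower_unitri v -> f (u * v) = f u + f v) /\
  (forall j a, (1 <= j <= n)%N -> f (y_ j a) = if j == i then a else 0).

(* There is exactly one such homomorphism on U^-, because the y_j(a)
   generate U^-. *)
Definition phi i : 'M[F]_n.+1 -> F := xget (fun=> 0) [set f | is_phi i f].

Definition e_arg i a u : 'M[F]_n.+1 := x_ i ((a - 1) / phi i u) * u.

Definition e_dom i a u : Prop :=
  [/\ a != 0, lower_unitri u, phi i u != 0 & big_cell (e_arg i a u)].

Definition e_ i a u : 'M[F]_n.+1 := pi_mm (e_arg i a u).

End UnitriangularGroups.

(* A family (a_{k,j})_{1 <= k <= j <= n} is given by a function
   nat -> nat -> F of which only the values at 1 <= k <= j <= n are used. *)

Section RationalMaps.
Variables (F : fieldType) (n : nat).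
Implicit Types (alpha : F) (a : nat -> nat -> F).

Definition triangle := {p : 'I_n.+1 * 'I_n.+1 | (1 <= p.1 <= p.2)%N}.

Definition in_torus alpha a : Prop :=
  alpha != 0 /\ forall k j, (1 <= k <= j)%N -> (j <= n)%N -> a k j != 0.

(* The coordinates of (alpha, a), numbered by an enumeration of
   option triangle in which None stands for alpha. *)
Definition coords alpha a (s : 'I_#|{: option triangle}|) : F :=
  if enum_val s is Some p then a (val p).1 (val p).2 else alpha.

(* P holds on a nonempty, hence dense, Zariski open subset of the torus of
   all (alpha, a), namely on a principal open subset D <> 0 (F is meant to be
   infinite). *)
Definition generically (P : F -> (nat -> nat -> F) -> Prop) : Prop :=
  exists2 D : {mpoly F[#|{: option triangle}|]}, D != 0 &
    forall alpha a, in_torus alpha a ->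
      D.@[coords alpha a] != 0 -> P alpha a.

(* Equality of the rational maps on the torus that are represented by the
   partial maps f (with domain Df) and g (with domain Dg): the common domain
   is dense, and f and g agree on all of it. *)
Definition rational_map_eq (V : Type) (Df Dg : F -> (nat -> nat -> F) -> Prop)
    (f g : F -> (nat -> nat -> F) -> V) : Prop :=
  generically (fun alpha a => Df alpha a /\ Dg alpha a) /\
  (forall alpha a, in_torus alpha a -> Df alpha a -> Dg alpha a ->
     f alpha a = g alpha a).

Definition Y a : 'M[F]_n.+1 :=
  \prod_(1 <= k < n.+1) \prod_(j <- rev (index_iota k n.+1)) y_ n j (a k j).

(* C^{(i)}_k. *)
Definition coefC i alpha a k : F :=
  (alpha * (\sum_(1 <= l < k.+1) a l i) + \sum_(k.+1 <= l < i.+1) a l i)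
  / \sum_(1 <= l < i.+1) a l i.

Definition a'_dom i alpha a : Prop :=
  \sum_(1 <= l < i.+1) a l i != 0 /\
  forall k, (k <= i)%N -> coefC i alpha a k != 0.

Definition a' i alpha a : nat -> nat -> F := fun k j =>
  if j == i.-1 then coefC i alpha a k * a k i.-1
  else if j == i then a k i / (coefC i alpha a k.-1 * coefC i alpha a k)
  else if j == i.+1 then coefC i alpha a k.-1 * a k i.+1
  else a k j.

End RationalMaps.

(* Main.v *)
(* Write G(c,t) = alpha_i^vee(c) x_i(t/c), the matrix [[c, t], [0, 1/c]] in rows
   and columns i, i + 1. It can be moved to the right across every y_j(b):
     G(c,t) y_i(b) = y_i(b / (c c')) G(c',t)  with c' = c + t b,
     G(c,t) y_{i-1}(b) = y_{i-1}(c b) G(c,t),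
     G(c,t) y_{i+1}(b) = y_{i+1}(c b) G(c,t),
   and G(c,t) commutes with the other y_j(b). For t = (alpha - 1) / phi_i(Y(a)),
   where phi_i(Y(a)) = sum_k a_{k,i}, the parameter c starts at C_0 = 1 and is C_k
   after the k-th row, so x_i(t) Y(a) = Y(a') G(alpha,t). This is a factorization
   in U^- T U, and such factorizations are unique. *)

Require Import Defs.
From mathcomp Require Import all_boot all_order all_algebra.
From mathcomp Require Import reals complex.
From mathcomp Require Import boolp classical_sets mpoly ring zify.

Set Implicit Arguments.
Unset Strict Implicit.
Unset Printing Implicit Defensive.

Import GRing.Theory Num.Theory.
Local Open Scope ring_scope.

(** * Unitriangular matrices and uniqueness of the factor in $U^-$ *)

Section BigCell.
Variables (F : fieldType) (n : nat).
Implicit Types (u v : 'M[F]_n.+1).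

Lemma lower_unitriP u :
  reflect ((forall r s : 'I_n.+1, (r < s)%N -> u r s = 0) /\
           forall r, u r r = 1) (lower_unitri u).
Proof.
apply: (iffP andP) => [[/is_trig_mxP u0 /forallP u1]|[u0 u1]]; split => //.
- by move=> r; apply/eqP.
- exact/is_trig_mxP.
- by apply/forallP => r; rewrite u1.
Qed.

Lemma upper_unitriP u :
  reflect ((forall r s : 'I_n.+1, (r < s)%N -> u s r = 0) /\
           forall r, u r r = 1) (upper_unitri u).
Proof.
apply: (iffP (lower_unitriP _)) => -[u0 u1].
  by split=> [r s /u0|r]; [rewrite mxE | rewrite -[RHS](u1 r) mxE].
by split=> [r s /u0|r]; rewrite mxE.
Qed.

Lemma lower_unitri1 : lower_unitri (1 : 'M[F]_n.+1).
Proof.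
apply/lower_unitriP; split => [r s|r]; rewrite !mxE ?eqxx //.
by rewrite -val_eqE /=; case: ltngtP.
Qed.

Lemma lower_unitriM u v :
  lower_unitri u -> lower_unitri v -> lower_unitri (u * v).
Proof.
move=> /lower_unitriP[u0 u1] /lower_unitriP[v0 v1].
apply/lower_unitriP; split => [r s rs|r]; rewrite mxE.
  apply: big1 => q _; have [rq|qr] := ltnP r q; first by rewrite u0 // mul0r.
  by rewrite v0 ?mulr0 // (leq_ltn_trans qr).
rewrite (bigD1 r) //= u1 v1 mul1r big1 ?addr0 // => q.
rewrite neq_ltn => /orP[qr|rq]; first by rewrite v0 ?mulr0.
by rewrite u0 ?mul0r.
Qed.

(* Row and column [s] of the two products determine row [s] of the upper factor
   and then column [s] of the lower one. *)
Lemma lu_unique (u v w z : 'M[F]_n.+1) :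
  lower_unitri u -> lower_unitri v ->
  (forall r s : 'I_n.+1, (r < s)%N -> w s r = 0) ->
  (forall r s : 'I_n.+1, (r < s)%N -> z s r = 0) ->
  (forall r, w r r != 0) -> u * w = v * z -> u = v.
Proof.
move=> /lower_unitriP[u0 u1] /lower_unitriP[v0 v1] w0 z0 wr uwE.
have sumI (A B : 'I_n.+1 -> F) s : \sum_q A q = \sum_q B q ->
    (forall q, q != s -> A q = B q) -> A s = B s.
  by move=> + AqB; rewrite (bigD1 s) //= [RHS](bigD1 s) //= (eq_bigr _ AqB) => /addIr.
suff H m (s : 'I_n.+1) : (s < m)%N ->
    (forall p, w s p = z s p) /\ (forall r, u r s = v r s).
  by apply/matrixP => r s; have [_ ->] := H s.+1 s (leqnn _).
elim: m s => // m IHm s; rewrite ltnS => sm.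
(* In row [s], terms with [q < s] agree by induction and terms with [q > s] vanish by lower
   triangularity; the term [q = s] remains, with coefficient 1. *)
have ws p : w s p = z s p.
  rewrite -[LHS]mul1r -[RHS]mul1r -{1}(u1 s) -(v1 s).
  apply: (sumI (fun q => u s q * w q p) (fun q => v s q * z q p)).
    by move/matrixP/(_ s p): uwE; rewrite !mxE.
  move=> q; rewrite neq_ltn => /orP[qs|sq].
    by have [-> ->] := IHm q (leq_trans qs sm).
  by rewrite u0 // v0 // !mul0r.
split=> // r; apply: (mulIf (wr s)); rewrite [in RHS]ws.
apply: (sumI (fun q => u r q * w q s) (fun q => v r q * z q s)).
  by move/matrixP/(_ r s): uwE; rewrite !mxE.
move=> q; rewrite neq_ltn => /orP[qs|sq].
  by have [-> ->] := IHm q (leq_trans qs sm).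
by rewrite w0 // z0 // !mulr0.
Qed.

(** The diagonal entries of [t] have product $\det t = 1$, so none vanishes. This gives [t * w] the
    shape that [lu_unique] asks of upper factors. *)
Lemma torus_upperP (t w : 'M[F]_n.+1) : diag_torus t -> upper_unitri w ->
  (forall r s : 'I_n.+1, (r < s)%N -> (t * w) s r = 0) /\
  (forall r, (t * w) r r != 0).
Proof.
move=> /andP[/is_diag_mxP tD /eqP tdet] /upper_unitriP[w0 w1].
have tE r s : (t * w) r s = t r r * w r s.
  rewrite mxE (bigD1 r) //= big1 ?addr0 // => q qr.
  by rewrite tD ?mul0r // eq_sym.
split=> [r s rs|r]; rewrite tE; first by rewrite w0 ?mulr0.
rewrite w1 mulr1.
have: \prod_q t q q != 0.
  rewrite -det_trig ?tdet ?oner_eq0 //.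
  by apply: is_diag_mx_is_trig; apply/is_diag_mxP.
by move/prodf_neq0; apply.
Qed.

(** Reduces the computation of [pi_mm] to exhibiting one factorization. *)
Lemma pi_mm_eq (g v : 'M[F]_n.+1) : lower_factor g v -> pi_mm g = v.
Proof.
move=> gv; apply: xget_unique => // v' [t' [w' [v'L t'T w'U gE']]].
case: gv => t [w [vL tT wU gE]].
have [tw0 twr] := torus_upperP tT wU; have [tw0' twr'] := torus_upperP t'T w'U.
by apply: (lu_unique v'L vL tw0' tw0 twr'); rewrite !mulrA -gE -gE'.
Qed.

(** * Elementary matrices and the membership of $Y(a)$ in $U^-$ *)

Lemma val_inord j : (j <= n)%N -> (inord j : 'I_n.+1) = j :> nat.
Proof. by move=> jn; rewrite inordK. Qed.

Lemma eq_inord (r : 'I_n.+1) j : (j <= n)%N -> (r == inord j) = (r == j :> nat).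
Proof. by move=> jn; rewrite -val_eqE /= inordK. Qed.

Lemma elemE (p q : 'I_n.+1) (a : F) r s : (1 + a *: delta_mx p q) r s =
  (r == s)%:R + a *+ ((r == p) && (s == q)).
Proof. by rewrite !mxE mulr_natr. Qed.

Lemma mul_elemE u p q (a : F) r s :
  (u * (1 + a *: delta_mx p q)) r s = u r s + a * u r p *+ (s == q).
Proof.
rewrite mulrDr mulr1 mxE; congr (_ + _).
rewrite mxE (bigD1 p) //= !mxE eqxx big1 ?addr0.
  by rewrite mulr_natr mulrnAr mulrC.
by move=> k /negPf kp; rewrite !mxE kp !mulr0.
Qed.

Lemma elem_mulE u p q (a : F) r s :
  ((1 + a *: delta_mx p q) * u) r s = u r s + a * u q s *+ (r == p).
Proof.
rewrite mulrDl mul1r mxE; congr (_ + _).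
rewrite mxE (bigD1 q) //= !mxE eqxx andbT big1 ?addr0.
  by rewrite mulr_natr mulrnAl.
by move=> k /negPf kq; rewrite !mxE kq andbF mulr0 mul0r.
Qed.

Lemma lower_unitri_y j a : (1 <= j <= n)%N -> lower_unitri (y_ n j a : 'M[F]_n.+1).
Proof.
move=> /andP[j1 jn]; have j1n : (j.-1 <= n)%N by lia.
apply/lower_unitriP; split => [r s rs|r]; rewrite elemE !eq_inord //.
  by rewrite -val_eqE /=; case: eqP => [|_]; case: andP => [|_]; rewrite ?addr0 //; lia.
by rewrite eqxx; case: andP => [|_]; rewrite ?addr0 //; lia.
Qed.

Lemma lower_unitri_prod (I : eqType) (l : seq I) (f : I -> 'M[F]_n.+1) :
  (forall j, j \in l -> lower_unitri (f j)) -> lower_unitri (\prod_(j <- l) f j).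
Proof.
move=> fL; rewrite big_seq; apply: (big_ind (fun u => lower_unitri u)) => //.
  exact: lower_unitri1.
exact: lower_unitriM.
Qed.

Lemma lower_unitri_row k (f : nat -> F) : (1 <= k)%N ->
  lower_unitri (\prod_(j <- rev (index_iota k n.+1)) y_ n j (f j)).
Proof.
move=> k1; apply: lower_unitri_prod => j.
by rewrite mem_rev mem_index_iota => kj; apply: lower_unitri_y; lia.
Qed.

Lemma lower_unitri_Y (b : nat -> nat -> F) : lower_unitri (Y n b).
Proof.
apply: lower_unitri_prod => k; rewrite mem_index_iota => /andP[k1 _].
exact: lower_unitri_row.
Qed.

(** * The homomorphism $\varphi_i$ and its value at $Y(a)$ *)

Lemma subdiag_is_phi i : (1 <= i <= n)%N ->
  is_phi i (fun u : 'M[F]_n.+1 => u (inord i) (inord i.-1)).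
Proof.
move=> /andP[i1 ilen]; have i1n : (i.-1 <= n)%N by lia.
split=> [u v /lower_unitriP[u0 u1] /lower_unitriP[v0 v1]|j a /andP[j1 jn]].
  (* By triangularity only the two summands [q = i] and [q = i.-1] survive, each with a diagonal
     factor 1, so this entry is additive. *)
  rewrite mxE (bigD1 (inord i)) //= (bigD1 (inord i.-1)) /=; last first.
    by rewrite eq_inord // val_inord //; lia.
  rewrite u1 v1 mul1r mulr1 big1 ?addr0 1?addrC // => q.
  rewrite !eq_inord // => /andP[qi qi1].
  have [iq|qi'] := ltnP i q; first by rewrite u0 ?mul0r // val_inord.
  by rewrite v0 ?mulr0 // val_inord //; lia.
have j1n : (j.-1 <= n)%N by lia.
rewrite elemE !eq_inord // !val_inord //.
have -> : (i == i.-1) = false by lia.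
have -> : (i == j) && (i.-1 == j.-1) = (j == i) by lia.
by rewrite add0r; case: eqP.
Qed.

(** The subdiagonal entry witnesses existence, so the default of [xget] is not taken. *)
Lemma phiP i : (1 <= i <= n)%N -> is_phi i (phi i : 'M[F]_n.+1 -> F).
Proof. by move=> ii; apply: xgetPex; eexists; apply: subdiag_is_phi. Qed.

Lemma phi_prod i (I : eqType) (s : seq I) (f : I -> 'M[F]_n.+1) :
  (1 <= i <= n)%N -> (forall j, j \in s -> lower_unitri (f j)) ->
  phi i (\prod_(j <- s) f j) = \sum_(j <- s) phi i (f j).
Proof.
move=> ii fL; have [phiD _] := phiP ii.
have phi1 : phi i (1 : 'M[F]_n.+1) = 0.
  have /eqP := phiD _ _ lower_unitri1 lower_unitri1.
  by rewrite mulr1 -subr_eq subrr eq_sym => /eqP.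
rewrite big_seq [RHS]big_seq.
(* Additivity of [phi i] is available on $U^-$, so membership in $U^-$ is carried through the
   induction. *)
suff [] : lower_unitri (\prod_(j <- s | j \in s) f j) /\
  phi i (\prod_(j <- s | j \in s) f j) = \sum_(j <- s | j \in s) phi i (f j).
  by [].
apply: (big_ind2 (fun u x => lower_unitri u /\ phi i u = x)) => //.
- by split => //; apply: lower_unitri1.
- move=> u x v y [uL <-] [vL <-]; split; first exact: lower_unitriM.
  exact: phiD.
by move=> j /fL.
Qed.

Lemma phi_Y i (b : nat -> nat -> F) :
  (1 <= i <= n)%N ->
  phi i (Y n b) = \sum_(1 <= l < i.+1) b l i.
Proof.
move=> ilen.
have rowL k j : (1 <= k <= n)%N -> j \in rev (index_iota k n.+1) ->
    (1 <= j <= n)%N.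
  by rewrite mem_rev mem_index_iota; lia.
have [_ phiy] := phiP ilen.
rewrite phi_prod //; last first.
  by move=> k; rewrite mem_index_iota => /andP[k1 _]; apply: lower_unitri_row.
(* Row [k] runs over [j >= k], so it contains the factor $y_i$ once if [k <= i] and not at all
   otherwise. *)
rewrite (eq_big_nat _ _ (F2 := fun k => if (k <= i)%N then b k i else 0)); last first.
  move=> k kn; rewrite phi_prod //; last first.
    by move=> j jk; apply/lower_unitri_y/(rowL k).
  rewrite big_seq (eq_bigr (fun j => if j == i then b k j else 0)); last first.
    by move=> j jk; apply: phiy; apply: (rowL k).
  rewrite -big_seq -big_mkcond /=.
  rewrite (perm_big (index_iota k n.+1)) ?perm_rev //=.
  rewrite -big_filter; case: ifP => ki.
    rewrite (_ : filter _ _ = [:: i]) ?big_seq1 //.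
    rewrite (filter_pred1_uniq (iota_uniq _ _)) //.
    by rewrite mem_index_iota; lia.
  rewrite (_ : filter _ _ = [::]) ?big_nil //.
  apply/eqP; rewrite -(negbK (_ == _)) -has_filter; apply/hasPn => j.
  by rewrite mem_index_iota; lia.
rewrite -big_mkcond /= (big_cat_nat (n := i.+1)) //=; last by lia.
rewrite [X in _ + X]big_nat_cond [X in _ + X]big1 ?addr0; last first.
  by move=> k kn; exfalso; lia.
by apply: congr_big_nat => // k; lia.
Qed.

End BigCell.

(** * Moving a varying factor across an ordered product *)

Lemma intertwine_up (R : pzSemiRingType) (g f f' : nat -> R) m :
  (forall k, (1 <= k <= m)%N -> g k.-1 * f k = f' k * g k) ->
  g 0 * \prod_(1 <= k < m.+1) f k = (\prod_(1 <= k < m.+1) f' k) * g m.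
Proof.
elim: m => [|m IHm] gf; first by rewrite !big_nil mulr1 mul1r.
rewrite !(big_nat_recr m.+1) //= mulrA IHm; last by move=> k km; apply: gf; lia.
by rewrite -!mulrA (gf m.+1) //; lia.
Qed.

(** Version for decreasing indices, the order of the factors within a row of $Y(a)$; [g j.+1] stands
    to the left of [f j] and leaves as [g j]. *)
Lemma intertwine_down (R : pzSemiRingType) (g f f' : nat -> R) k m :
  (k <= m)%N -> (forall j, (k <= j < m)%N -> g j.+1 * f j = f' j * g j) ->
  g m * \prod_(j <- rev (index_iota k m)) f j =
  (\prod_(j <- rev (index_iota k m)) f' j) * g k.
Proof.
elim: m => [|m IHm] km gf.
  by move: km; rewrite leqn0 => /eqP ->; rewrite !big_nil mulr1 mul1r.
move: km; rewrite leq_eqVlt => /orP[/eqP <-|]; last rewrite ltnS => km.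
  by rewrite /index_iota subnn !big_nil mulr1 mul1r.
have -> : rev (index_iota k m.+1) = m :: rev (index_iota k m).
  by rewrite /index_iota subSn // -addn1 iotaD rev_cat /= subnKC.
rewrite !big_cons mulrA gf; last by rewrite km ltnS leqnn.
by rewrite -!mulrA IHm // => j /andP[kj jm]; apply: gf; rewrite kj ltnS ltnW.
Qed.

(** * The matrices $G(c,t)$ and their relations with the $y_j(b)$ *)

Section Intertwining.
Variables (F : fieldType) (n i : nat).
Hypothesis ilen : (1 <= i <= n)%N.
Implicit Types (c t b : F).

(** Diagonal of $\alpha_i^\vee(c)$, with positions counted from 0. *)
Definition torus_wt c j : F :=
  if j == i.-1 then c else if j == i then c^-1 else 1.

Definition borel_mx c t : 'M[F]_n.+1 := \matrix_(r, s)
  (torus_wt c r *+ (r == s) + t *+ ((r == i.-1 :> nat) && (s == i :> nat))).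

Lemma borel_mx1 t : borel_mx 1 t = x_ n i t.
Proof.
have /andP[i1 iN] := ilen; have i1n : (i.-1 <= n)%N by lia.
apply/matrixP => r s; rewrite !mxE !eq_inord // mulr_natr; congr (_ + _).
by rewrite /torus_wt invr1 !if_same.
Qed.

(** For $j\ne i$ both products of $E_{i,i+1}$ and $E_{j+1,j}$ vanish, so only conjugation by the
    diagonal part acts, scaling $E_{j+1,j}$ by a ratio of weights. This treats $j=i-1$, $j=i+1$ and
    the commuting case together. *)
Lemma borel_y c t j b : c != 0 -> (1 <= j <= n)%N -> j != i ->
  borel_mx c t * y_ n j b =
  y_ n j (torus_wt c j * b / torus_wt c j.-1) * borel_mx c t.
Proof.
move=> c0 /andP[j1 jn] ji; have /andP[i1 iN] := ilen.
have i1n : (i.-1 <= n)%N by lia.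
have j1n : (j.-1 <= n)%N by lia.
have wt0 k : torus_wt c k != 0.
  by rewrite /torus_wt; do 2?[case: ifP => _]; rewrite ?invr_eq0 ?oner_eq0.
apply/matrixP => r s; rewrite mul_elemE elem_mulE; congr (_ + _).
rewrite !mxE !eq_inord // [inord _ == s]eq_sym eq_inord // !inordK //.
have -> : (j == i) = false by lia.
have -> : (j.-1 == i.-1) = false by lia.
rewrite andbF /= !mulr0n !addr0.
case: (s =P j.-1 :> nat) => _; case: (r =P j :> nat) => [->|_] /=.
- by field.
- by rewrite mulr0.
- by rewrite mulr0.
- by [].
Qed.

(** A $2\times2$ computation: both sides have rows $(c',t)$ and $(b/c,1/c)$ in the block of
    $i,i+1$. *)
Lemma borel_yi c c' t b : c != 0 -> c' != 0 -> c' = c + t * b ->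
  borel_mx c t * y_ n i b = y_ n i (b / (c * c')) * borel_mx c' t.
Proof.
move=> c0 c0' c'E; have /andP[i1 iN] := ilen.
have i1n : (i.-1 <= n)%N by lia.
apply/matrixP => r s; rewrite mul_elemE elem_mulE.
rewrite !mxE !eq_inord // [inord _ == s]eq_sym eq_inord // !inordK //.
rewrite -val_eqE /= /torus_wt !eqxx /=.
have ii' : (i.-1 == i) = false by lia.
case: (r =P i.-1 :> nat) => [->|r1].
  rewrite ii' /= [i.-1 == s]eq_sym; case: (s =P i.-1 :> nat) => [->|s1].
    by rewrite ii' /= c'E !(mulr1n, mulr0n); ring.
  by rewrite /= !(mulr1n, mulr0n, addr0, add0r).
case: (r =P i :> nat) => [->|r2] /=; last first.
  by rewrite !(mulr0n, addr0, mulr0, mul0rn).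
rewrite [i == s]eq_sym.
case: (s =P i.-1 :> nat) => [->|s1]; rewrite ?[i.-1 == i]ii'.
  by rewrite !(mulr1n, mulr0n) /=; field; rewrite c0 c0'.
case: (s =P i :> nat) => [_|s2] /=; rewrite !(mulr1n, mulr0n).
  by rewrite !add0r !addr0 c'E; field; rewrite -c'E c0 c0'.
by rewrite !(mulr0n, addr0, mulr0).
Qed.

End Intertwining.

(** * Moving $x_i(t)$ through $Y(a)$ row by row *)

Section Crystal.
Variables (F : fieldType) (n i : nat).
Hypothesis ilen : (1 <= i <= n)%N.
Variables (alpha : F) (a : nat -> nat -> F).
Let S := \sum_(1 <= l < i.+1) a l i.
Hypothesis aD : a'_dom i alpha a.
Local Notation C := (Defs.coefC i alpha a).
Let t := (alpha - 1) / S.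

Let S0 : S != 0. Proof. by case: aD. Qed.

Lemma coefC_first : C 0 = 1.
Proof. by rewrite /Defs.coefC [\sum_(1 <= l < 1) _]big_geq // mulr0 add0r divff. Qed.

Lemma coefC_last : C i = alpha.
Proof. by rewrite /Defs.coefC [\sum_(i.+1 <= l < i.+1) _]big_geq // addr0 mulfK. Qed.

(** The summand $a_{k,i}$ acquires the coefficient $\alpha$, which raises the numerator by
    $(\alpha-1)a_{k,i}$. This is the relation $c'=c+tb$ of [borel_yi]. *)
Lemma coefC_step k : (1 <= k <= i)%N ->
  C k = C k.-1 + t * a k i.
Proof.
case: k => // k /andP[_ ki].
rewrite /Defs.coefC /= big_nat_recr //= [X in _ = (_ + X) / _ + _]big_ltn //.
by rewrite /t -/S; field.
Qed.

(* Rows k > i contain no factor y_i, so the parameter stays at C_i. *)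
Let d k := C (minn k i).

Let d_neq0 k : d k != 0.
Proof. by case: aD => _; apply; apply: geq_minr. Qed.

Lemma borel_row k : (1 <= k <= n)%N ->
  borel_mx n i (d k.-1) t * (\prod_(j <- rev (index_iota k n.+1)) y_ n j (a k j)) =
  (\prod_(j <- rev (index_iota k n.+1)) y_ n j (a' i alpha a k j)) *
    borel_mx n i (d k) t.
Proof.
move=> /andP[k1 kn]; have /andP[i1 iN] := ilen.
(* g j stands just before the factor y_{j-1} of the k-th row: the parameter C_{k-1}
   becomes C_k when y_i is passed. *)
pose g j := borel_mx n i (if (j <= i)%N then d k else d k.-1) t.
have gn : borel_mx n i (d k.-1) t = g n.+1 by rewrite /g ifF //; lia.
have gk : borel_mx n i (d k) t = g k.
  (* If [i < k], then [g k] carries [d k.-1], and both [d k.-1] and [d k] equal $C_i$. *)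
  rewrite /g; case: leqP => // ik; rewrite /d; congr (borel_mx n i (C _) t).
  lia.
rewrite gn gk; apply: intertwine_down => [|j /andP[kj jn]]; first lia.
have j1n : (1 <= j <= n)%N by lia.
have [ji|ji] := eqVneq j i.
  rewrite /g ji leqnn ltnn; rewrite ji in kj.
  have dk1 : d k.-1 = C k.-1 by congr (C _); lia.
  have dk : d k = C k by congr (C _); lia.
  rewrite (@borel_yi _ n i ilen _ (d k)) ?d_neq0 //; last first.
    by rewrite dk dk1 coefC_step // k1.
  by rewrite /a' ifF ?eqxx ?dk ?dk1 //; lia.
have -> : g j.+1 = g j by rewrite /g [(j <= i)%N]leq_eqVlt (negPf ji).
rewrite /g borel_y //; last by case: ifP; rewrite d_neq0.
congr (y_ n j _ * _); rewrite /a' /torus_wt (negPf ji).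
(* The factor $y_{i-1}$ is met after $y_i$ and is scaled by $C_k$; $y_{i+1}$ is met before it and is
   scaled by $C_{k-1}$. Here $k\le j$ removes the truncation in [d], even for $k=j=i+1$. *)
have [jE|ji1] := eqVneq j i.-1.
  have -> : (j <= i)%N by lia.
  have -> : (j.-1 == i.-1) = false by lia.
  have -> : (j.-1 == i) = false by lia.
  rewrite divr1 jE; congr (C _ * _); lia.
have [jE|jS] := eqVneq j i.+1.
  have -> : (j <= i)%N = false by lia.
  have -> : (j.-1 == i.-1) = false by lia.
  have -> : (j.-1 == i) by lia.
  rewrite mul1r invrK jE mulrC; congr (C _ * _); lia.
have -> : (j.-1 == i.-1) = false by lia.
have -> : (j.-1 == i) = false by lia.
by rewrite mul1r divr1.
Qed.

Lemma x_mul_Y : x_ n i t * Y n a = Y n (a' i alpha a) * borel_mx n i alpha t.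
Proof.
have d0 : d 0 = 1 by rewrite /d min0n coefC_first.
have dn : d n = alpha by rewrite /d (minn_idPr _) ?coefC_last //; case/andP: ilen.
(* The parameter is 1 before the first row, where $G(1,t)=x_i(t)$, and $\alpha$ after the last. *)
rewrite -borel_mx1 // -{1}d0 -[X in _ = _ * borel_mx _ _ X _]dn.
by apply: (intertwine_up (g := fun k => borel_mx n i (d k) t)) => k; exact: borel_row.
Qed.

End Crystal.

(** * The factorization in $U^-TU$ *)

Section Generic.
Variables (F : fieldType) (n i : nat).
Hypothesis ilen : (1 <= i <= n)%N.

Lemma upper_unitri_x (b : F) : upper_unitri (x_ n i b).
Proof.
have /andP[i1 iN] := ilen; have i1n : (i.-1 <= n)%N by lia.
apply/upper_unitriP; split => [r s rs|r]; rewrite elemE !eq_inord //.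
  by rewrite -val_eqE /=; case: eqP => [|_]; case: andP => [|_]; rewrite ?addr0 //; lia.
by rewrite eqxx; case: andP => [|_]; rewrite ?addr0 //; lia.
Qed.

(** Splits $G(c,t)$ into its torus part $G(c,0)=\alpha_i^\vee(c)$ and a factor in $U$. *)
Lemma borel_mxE (c t : F) : c != 0 ->
  borel_mx n i c t = borel_mx n i c 0 * x_ n i (t / c).
Proof.
move=> c0; have /andP[i1 iN] := ilen; have i1n : (i.-1 <= n)%N by lia.
apply/matrixP => r s; rewrite mul_elemE !mxE !mul0rn !addr0 !eq_inord //.
congr (_ + _); case: (r =P i.-1 :> nat) => [->|_] /=; last first.
  by rewrite mulr0 mul0rn.
by rewrite /torus_wt eqxx mulr1n divfK.
Qed.

Lemma diag_torus_borel (c : F) : c != 0 -> diag_torus (borel_mx n i c 0).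
Proof.
move=> c0; have /andP[i1 iN] := ilen; have i1n : (i.-1 <= n)%N by lia.
have tD : is_diag_mx (borel_mx n i c 0).
  by apply/is_diag_mxP => r s rs; rewrite mxE -val_eqE /= (negPf rs) mul0rn addr0.
rewrite /diag_torus tD det_trig ?is_diag_mx_is_trig //=; apply/eqP.
rewrite (bigD1 (inord i.-1)) //= (bigD1 (inord i)) /=; last first.
  by rewrite eq_inord // inordK //; lia.
rewrite big1 => [|r]; rewrite !mxE /torus_wt !eqxx !mul0rn !addr0 ?inordK //.
  have -> : (i == i.-1) = false by lia.
  by rewrite !eqxx mulr1 mulr1n divff.
by rewrite !eq_inord // => /andP[/negPf -> /negPf ->].
Qed.

Lemma lower_factor_Y (alpha : F) a : alpha != 0 -> a'_dom i alpha a ->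
  lower_factor (e_arg i alpha (Y n a)) (Y n (a' i alpha a)).
Proof.
move=> alpha0 aD; rewrite /e_arg phi_Y //.
exists (borel_mx n i alpha 0).
exists (x_ n i ((alpha - 1) / (\sum_(1 <= l < i.+1) a l i) / alpha)).
split; first exact: lower_unitri_Y.
- exact: (diag_torus_borel alpha0).
- exact: upper_unitri_x.
- by rewrite x_mul_Y // borel_mxE // mulrA.
Qed.

(** * A dense open set on which both maps are defined *)

Notation N := #|{: option (triangle n)}|.

Definition var_alpha : {mpoly F[N]} := 'X_(enum_rank None).

Definition var_a k j : {mpoly F[N]} :=
  if insub (inord k, inord j) is Some p then 'X_(enum_rank (Some p)) else 0.

Lemma meval_var_alpha alpha a : var_alpha.@[coords alpha a] = alpha.
Proof. by rewrite mevalXU /coords enum_rankK. Qed.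

Lemma meval_var_a alpha a k j : (1 <= k <= j)%N -> (j <= n)%N ->
  (var_a k j).@[coords alpha a] = a k j.
Proof.
move=> kj jn; have kn : (k <= n)%N by lia.
by rewrite /var_a insubT /= ?inordK // => p; rewrite mevalXU /coords enum_rankK /= !inordK.
Qed.

(** The common denominator of the $C_k$ times all their numerators; where it is nonzero, [a'] is
    defined. *)
Definition a'_denom : {mpoly F[N]} :=
  (\sum_(1 <= l < i.+1) var_a l i) *
  \prod_(k < i.+1) (var_alpha * (\sum_(1 <= l < k.+1) var_a l i)
                    + \sum_(k.+1 <= l < i.+1) var_a l i).

Lemma meval_a'_denom alpha a : a'_denom.@[coords alpha a] =
  (\sum_(1 <= l < i.+1) a l i) *
  \prod_(k < i.+1) (alpha * (\sum_(1 <= l < k.+1) a l i)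
                    + \sum_(k.+1 <= l < i.+1) a l i).
Proof.
have sumE k m : (m <= i.+1)%N -> (0 < k)%N ->
    (\sum_(k <= l < m) var_a l i).@[coords alpha a] = \sum_(k <= l < m) a l i.
  move=> mi k0; rewrite raddf_sum; apply: eq_big_nat => l lm.
  by apply: meval_var_a; lia.
rewrite mevalM sumE // rmorph_prod; congr (_ * _); apply: eq_bigr => k _.
by rewrite /= mevalD mevalM meval_var_alpha !sumE.
Qed.

Lemma a'_denom_neq0 : [pchar F] =i pred0 -> a'_denom != 0.
Proof.
move=> F0; apply/eqP => D0.
(* At $\alpha=1$ and all $a_{k,j}=1$ every factor takes the value $i$, nonzero in characteristic
   0. *)
have := meval_a'_denom 1 (fun _ _ => 1); rewrite D0 meval0 => /esym/eqP.
have i0 : i%:R != 0 :> F by rewrite (iffLR (pcharf0P _) F0); lia.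
have sum1 : \sum_(1 <= l < i.+1) 1 = i%:R :> F by rewrite sumr_const_nat subn1.
apply/negP; rewrite sum1 mulf_neq0 //; apply/prodf_neq0 => k _.
by rewrite mul1r -big_cat_nat ?sum1.
Qed.

Lemma a'_domP alpha a : a'_denom.@[coords alpha a] != 0 -> a'_dom i alpha a.
Proof.
rewrite meval_a'_denom mulf_eq0 negb_or => /andP[S0 /prodf_neq0 P0].
split=> // k ki; rewrite mulf_neq0 ?invr_eq0 //.
by apply: (P0 (Ordinal (ki : (k < i.+1)%N))).
Qed.

Lemma crystal_rational_map_eq : [pchar F] =i pred0 ->
  @rational_map_eq F n 'M[F]_n.+1
    (fun alpha a => e_dom i alpha (Y n a))
    (fun alpha a => a'_dom i alpha a)
    (fun alpha a => e_ i alpha (Y n a))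
    (fun alpha a => Y n (a' i alpha a)).
Proof.
move=> F0; split=> [|alpha a [alpha0 _] _ aD]; last first.
  by apply: pi_mm_eq; apply: lower_factor_Y.
exists a'_denom => [|alpha a [alpha0 _] /a'_domP aD]; first exact: a'_denom_neq0.
split=> //; split=> //; first exact: lower_unitri_Y.
  by rewrite phi_Y //; case: aD.
by exists (Y n (a' i alpha a)); apply: lower_factor_Y.
Qed.

End Generic.

Theorem proposition4p3 (R : realType) (n i : nat)
    (hn : (1 <= n)%N) (hi : (1 <= i <= n)%N) :
  @rational_map_eq R[i]%C n 'M[R[i]%C]_n.+1
    (fun alpha a => e_dom i alpha (Y n a))
    (fun alpha a => a'_dom i alpha a)
    (fun alpha a => e_ i alpha (Y n a))
    (fun alpha a => Y n (a' i alpha a)).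
Proof. exact/crystal_rational_map_eq/pchar_num. Qed.
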